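(* Let $\widehat{A}=A+\varepsilon B$ be an $n\times n$ dual matrix with $A,B\in\mathbb{R}^{n\times n}$. Then the dual core generalized inverse of $\widehat{A}$ exists if and only if $\mathrm{Ind}(A)=1$ and $(I_n-AA^{\mathrm{c}})B(I_n-A^{\mathrm{c}}A)=0$, where $A^{\mathrm{c}}$ denotes the core inverse of $A$.
   Context: Dual numbers are $a+\varepsilon a'$ with $a,a'\in\mathbb{R}$ and $\varepsilon\neq 0$, $\varepsilon^2=0$ (i.e. the ring $\mathbb{R}[\varepsilon]/(\varepsilon^2)$). A dual matrix is a matrix over dual numbers, written $\widehat{A}=A+\varepsilon B$ with $A,B$ real; its transpose is $\widehat{A}^{T}=A^{T}+\varepsilon B^{T}$. The dual core generalized inverse (DCGI) of an $n\times n$ dual matrix $\widehat{A}$ is an $n\times n$ dual matrix $\widehat{G}$ with $\widehat{A}\widehat{G}\widehat{A}=\widehat{A}$, $\widehat{A}\widehat{G}^2=\widehat{G}$, $(\widehat{A}\widehat{G})^{T}=\widehat{A}\widehat{G}$; it may or may not exist. For a real square matrix $A$, ''$\mathrm{Ind}(A)=1$'' means $\mathrm{rank}(A^2)=\mathrm{rank}(A)$; in that case the core inverse $A^{\mathrm{c}}$ of $A$ is the unique real matrix $X$ with $AXA=A$, $AX^2=X$, $(AX)^{T}=AX$. *)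

(* Defs.v *)
From mathcomp Require Import all_boot all_order all_algebra.
From mathcomp Require Import boolp classical_sets reals.

Set Implicit Arguments.
Unset Strict Implicit.
Unset Printing Implicit Defensive.

Import GRing.Theory.
Local Open Scope ring_scope.

Notation dual R := {poly %/ ('X^2 : {poly R})}.

Definition eps (R : realType) : dual R := qpolyX 'X^2.

Definition dual_mx (R : realType) (m n : nat) (A B : 'M[R]_(m, n)) :
    'M[dual R]_(m, n) :=
  map_mx (qpolyC 'X^2) A + eps R *: map_mx (qpolyC 'X^2) B.

(* The same three equations define the core inverse (S = R) and the dual core
   generalized inverse (S = dual R). *)
Definition is_core_inverse (S : comNzRingType) (n : nat) (A X : 'M[S]_n) :
    Prop :=
  [/\ A *m X *m A = A, A *m (X *m X) = X & (A *m X)^T = A *m X].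

Definition index_one (R : realType) (n : nat) (A : 'M[R]_n) : Prop :=
  \rank (A *m A) = \rank A.

(* Total: the default value 0 is returned when A has no core inverse, which
   does not happen when [index_one A] holds. *)
Definition core_inverse (R : realType) (n : nat) (A : 'M[R]_n) : 'M[R]_n :=
  xget 0 [set X | is_core_inverse A X]%classic.

Definition has_dcgi (R : realType) (n : nat) (M : 'M[dual R]_n) : Prop :=
  exists G : 'M[dual R]_n, is_core_inverse M G.

Lemma eps_neq0 (R : realType) : eps R != 0.
Proof.
apply/eqP => /(congr1 val) /=.
by move/eqP; rewrite mk_monic_Xn /= Pdiv.CommonRing.rmodp_small
  ?size_polyX ?size_polyXn // polyX_eq0.
Qed.

Lemma eps_sqr (R : realType) : eps R ^+ 2 = 0.
Proof.
rewrite /eps /qpolyX -rmorphXn; apply: val_inj => /=.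
by rewrite mk_monic_Xn Pdiv.RingMonic.rmodpp ?monicXn.
Qed.

Lemma dual_mxP (R : realType) (m n : nat) (M : 'M[dual R]_(m, n)) :
  exists! AB : 'M[R]_(m, n) * 'M[R]_(m, n), M = dual_mx AB.1 AB.2.
Proof.
have valE A B i j : dual_mx A B i j = A i j *: 1 + B i j *: 'X :> {poly R}.
  rewrite !mxE /= mk_monic_Xn /= [X in Pdiv.CommonRing.rmodp (X * _)]
    Pdiv.CommonRing.rmodp_small ?size_polyX ?size_polyXn //.
  rewrite Pdiv.CommonRing.rmodp_small; first by rewrite mulrC mul_polyC alg_polyC.
  rewrite size_polyXn mulrC mul_polyC (leq_ltn_trans (size_scale_leq _ _)) //.
  by rewrite size_polyX.
exists (\matrix_(i, j) (val (M i j))`_0, \matrix_(i, j) (val (M i j))`_1).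
split=> [|[A B] /= ->]; last first.
  by congr pair; apply/matrixP => i j; rewrite mxE valE;
    rewrite coefD !coefZ coef1 coefX /= ?(mulr0, mulr1, addr0, add0r).
apply/matrixP => i j; apply: val_inj; rewrite /= valE !mxE.
apply/polyP => k; rewrite coefD !coefZ coef1 coefX.
case: k => [|[|k]] /=; rewrite ?(mulr0, mulr1, addr0, add0r) //.
apply: nth_default; apply: leq_trans (size_npoly (M i j)) _.
by rewrite mk_monic_Xn size_polyXn.
Qed.

(* Main.v *)
(** Writing the dual matrix as [A + eps B] and a candidate inverse as
    [X + eps Y], the defining equations split into the real equations saying
    that [X] is the core inverse of [A], and three equations linear in [Y].
    Multiplying [AXB + AYA + BXA = B] by [1 - AX] and [1 - XA] eliminates [Y]
    and yields the rank condition; conversely, under that condition an explicit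
    [Y] solves the three equations.  The real core inverse comes from a
    full-rank factorization [A = F G], as [F (GF)^-1 (F^T F)^-1 F^T]. *)
Require Import Defs.
From mathcomp Require Import all_boot all_order all_algebra.
From mathcomp Require Import boolp classical_sets reals.

Set Implicit Arguments.
Unset Strict Implicit.
Unset Printing Implicit Defensive.

Import GRing.Theory Num.Theory.
Local Open Scope ring_scope.

Section DualMatrices.
Variable R : realType.

Lemma mul_dual_mx (m n p : nat) (A B : 'M[R]_(m, n)) (C D : 'M[R]_(n, p)) :
  dual_mx A B *m dual_mx C D = dual_mx (A *m C) (A *m D + B *m C).
Proof.
rewrite /dual_mx mulmxDl !mulmxDr -!scalemxAl -!scalemxAr scalerA -expr2.
by rewrite eps_sqr scale0r addr0 map_mxD !map_mxM scalerDr addrA.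
Qed.

Lemma tr_dual_mx (m n : nat) (A B : 'M[R]_(m, n)) :
  (dual_mx A B)^T = dual_mx A^T B^T.
Proof. by rewrite /dual_mx linearD linearZ /= !map_trmx. Qed.

Lemma dual_mx_inj (m n : nat) (A B C D : 'M[R]_(m, n)) :
  dual_mx A B = dual_mx C D <-> A = C /\ B = D.
Proof.
split=> [eq_d | [-> ->] //]; have [U [_ uniqU]] := dual_mxP (dual_mx A B).
have := uniqU (C, D) eq_d; rewrite (uniqU (A, B) erefl).
by case=> -> ->.
Qed.

Lemma is_core_inverse_dual (n : nat) (A B X Y : 'M[R]_n) :
  is_core_inverse (dual_mx A B) (dual_mx X Y) <->
  [/\ is_core_inverse A X,
      A *m X *m B + (A *m Y + B *m X) *m A = B,
      A *m (X *m Y + Y *m X) + B *m (X *m X) = Y &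
      (A *m Y + B *m X)^T = A *m Y + B *m X].
Proof.
rewrite /is_core_inverse !mul_dual_mx tr_dual_mx; split.
  by case=> /dual_mx_inj[? ?] /dual_mx_inj[? ?] /dual_mx_inj[? ?].
by case=> -[? ? ?] ? ? ?; split; apply/dual_mx_inj.
Qed.

Lemma has_dcgiP (n : nat) (A B : 'M[R]_n) :
  has_dcgi (dual_mx A B) <->
  exists X Y, is_core_inverse (dual_mx A B) (dual_mx X Y).
Proof.
split=> [[G] | [X [Y]]]; last by exists (dual_mx X Y).
by have [[X Y] [-> _]] := dual_mxP G; exists X, Y.
Qed.

End DualMatrices.

Section RealCoreInverse.
Variable R : realType.

(** If [v] kills the Gram matrix, then [v *m F^T] has zero sum of squares, so it vanishes over the
    reals; the rows of [F^T] being free, [v = 0]. *)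
Lemma unitmx_gram (m r : nat) (F : 'M[R]_(m, r)) :
  row_full F -> F^T *m F \in unitmx.
Proof.
move=> fullF; rewrite -row_free_unit -kermx_eq0; apply/eqP/row_matrixP => i.
rewrite row0; set v := row i _.
have vFF0 : v *m (F^T *m F) = 0.
  by apply/sub_kermxP; rewrite row_sub.
have vF0 : v *m F^T = 0.
  have /matrixP/(_ ord0 ord0) : v *m F^T *m (v *m F^T)^T = 0.
    by rewrite trmx_mul trmxK -!mulmxA (mulmxA _ F) (mulmxA v) vFF0 mul0mx.
  rewrite !mxE => /eqP; rewrite psumr_eq0 => [/allP z|j _]; last first.
    by rewrite [_^T _ _]mxE -expr2 sqr_ge0.
  apply/rowP => j; have := z j (mem_index_enum j).
  by rewrite [_^T _ _]mxE mulf_eq0 orbb mxE [RHS]mxE => /eqP.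
have freeFt : row_free F^T by rewrite /row_free mxrank_tr.
by apply: (row_free_inj freeFt); rewrite vF0 mul0mx.
Qed.

Lemma index_one_core_inverse (n : nat) (A : 'M[R]_n) :
  index_one A -> exists X, is_core_inverse A X.
Proof.
rewrite /index_one => indA; set F := col_base A; set G := row_base A.
have FG : F *m G = A by rewrite mulmx_base.
have uFF : F^T *m F \in unitmx by apply: unitmx_gram; rewrite col_base_full.
(* Since [A *m A = F *m (G *m F) *m G] has the rank of [A], the square matrix [G *m F] of that size
   has full rank. *)
have uGF : G *m F \in unitmx.
  rewrite -row_free_unit /row_free eqn_leq rank_leq_row /= -{1}indA.
  rewrite -[X in \rank (X *m X)]FG mulmxA -(mulmxA F).
  by apply: leq_trans (mxrankM_maxl _ _) (mxrankM_maxr _ _).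
clearbody F G; exists (F *m invmx (G *m F) *m invmx (F^T *m F) *m F^T).
set X := (X in is_core_inverse _ X).
have AX : A *m X = F *m invmx (F^T *m F) *m F^T.
  by rewrite -[A in LHS]FG /X !mulmxA -(mulmxA F G) mulmxK.
have AXF : A *m X *m F = F by rewrite AX -!mulmxA mulVmx // mulmx1.
have [Z XE] : exists Z, X = F *m Z by eexists; rewrite /X -!mulmxA.
clearbody X; split.
- by rewrite -[X in _ *m X = X]FG mulmxA AXF.
- by rewrite XE 2!mulmxA -XE AXF.
- by rewrite AX !trmx_mul trmxK trmx_inv trmx_mul trmxK mulmxA.
Qed.

(** Substituting [X = A *m (X *m X)] into [A *m X *m A] makes [A] a right multiple of [A *m A]. *)
Lemma core_inverse_index_one (n : nat) (A X : 'M[R]_n) :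
  is_core_inverse A X -> index_one A.
Proof.
case=> AXA AXX _; apply/eqP; rewrite eqn_leq mxrankM_maxl /=.
rewrite -[X in (\rank X <= _)%N]AXA -{1}AXX !mulmxA.
by rewrite -!(mulmxA (A *m A)) mxrankM_maxl.
Qed.

Lemma index_one_lcancel (n : nat) (A : 'M[R]_n) :
  index_one A -> exists W, A = W *m (A *m A).
Proof.
move=> indA; apply/submxP; have /eqP := indA.
by rewrite (mxrank_leqif_sup (submxMl A A)).
Qed.

Lemma is_core_inverse_uniq (n : nat) (A X Y : 'M[R]_n) :
  is_core_inverse A X -> is_core_inverse A Y -> X = Y.
Proof.
move=> cX; have [W AE] := index_one_lcancel (core_inverse_index_one cX).
case: cX => AXA AXX sX [AYA AYY sY].
(* Transposing [(A *m Y) *m (A *m X) = A *m X] swaps the two symmetric factors, and the swapped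
   product is [A *m Y]. *)
have eqAXY : A *m X = A *m Y.
  by rewrite -sX -{1}AYA -mulmxA trmx_mul sX sY mulmxA AXA.
have inv_W Z : A *m (Z *m Z) = Z -> Z = W *m (A *m Z).
  by move=> AZZ; rewrite -{1}AZZ {1}AE -!mulmxA AZZ.
by rewrite (inv_W X) // (inv_W Y) // eqAXY.
Qed.

(** Uniqueness pins down the choice made by [xget]. *)
Lemma core_inverseE (n : nat) (A X : 'M[R]_n) :
  is_core_inverse A X -> core_inverse A = X.
Proof.
by move=> cX; apply: xget_unique => // Y cY; apply: is_core_inverse_uniq cY cX.
Qed.

Lemma core_inverse_inner (n : nat) (A X : 'M[R]_n) :
  is_core_inverse A X -> X *m A *m X = X.
Proof.
move=> cX; have [W AE] := index_one_lcancel (core_inverse_index_one cX).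
case: cX => AXA AXX _.
have XW : X = W *m (A *m X) by rewrite -{1}AXX {1}AE -!mulmxA AXX.
have AXAX : A *m (X *m (A *m X)) = A *m X by rewrite !mulmxA AXA.
by rewrite {1}XW -!mulmxA AXAX -XW.
Qed.

End RealCoreInverse.

(* In an orthonormal basis adapted to the range of [A] one has
   [A = [[T, S], [0, 0]]] and [B = [[B1, B2], [B3, B3 T^-1 S]]], so
   [A + eps B = [1; eps C] [T + eps B1, S + eps B2]] with [C = B3 T^-1].
   The dual part of the core inverse read off this full-rank factorization is
   [Y] below; [K] is the block [C]. *)
Lemma dual_core_inverse_exists (R : realType) (n : nat) (A B X : 'M[R]_n) :
    is_core_inverse A X ->
    (1%:M - A *m X) *m B *m (1%:M - X *m A) = 0 ->
  exists Y, is_core_inverse (dual_mx A B) (dual_mx X Y).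
Proof.
move=> cX; have XAX := core_inverse_inner cX; have [AXA AXX sX] := cX.
set P := A *m X => condB.
set K := (1%:M - P) *m B *m X.
exists (- (X *m B *m X) - X *m A *m K *m X + X *m K^T + K *m X).
set Y := (Y in dual_mx X Y).
have PP : P *m P = P by rewrite {2}/P mulmxA AXA.
have PX : P *m X = X by rewrite -mulmxA.
have PK : P *m K = 0 by rewrite /K !mulmxA mulmxBr mulmx1 PP subrr !mul0mx.
have KP : K *m P = K by rewrite /K -!mulmxA (mulmxA X) XAX.
have PKt : P *m K^T = K^T by rewrite -[P]sX -trmx_mul KP.
have KtP : K^T *m P = 0 by rewrite -[P]sX -trmx_mul PK trmx0.
have KtA : K^T *m A = 0 by rewrite -AXA mulmxA KtP mul0mx.
have KtX : K^T *m X = 0 by rewrite -PX mulmxA KtP mul0mx.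
have KE : K = B *m X - P *m B *m X by rewrite /K !mulmxBl mul1mx.
(* The hypothesis [condB] enters only here, as [(1 - P) B = (1 - P) B X A]. *)
have KA : K *m A = B - P *m B.
  rewrite /K -mulmxA; move/eqP: condB.
  by rewrite mulmxBr mulmx1 subr_eq0 => /eqP <-; rewrite mulmxBl mul1mx.
have PE : A *m X = P by [].
have YE : Y = - (X *m B *m X) - X *m A *m K *m X + X *m K^T + K *m X by [].
rewrite PE in AXA sX; clearbody Y K P.
(* The term [- X *m A *m K *m X] of [Y] cancels the contribution of [K *m X], [X *m K^T] contributes
   [K^T], and [B *m X - P *m B *m X] is [K]. *)
have AYBX : A *m Y + B *m X = K + K^T.
  rewrite YE !mulmxDr !mulmxN !mulmxA PE AXA PKt.
  rewrite [_ - A *m K *m X + _]addrAC subrK -[B *m X](subrK (P *m B *m X)) -KE.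
  by rewrite [- _ + _]addrC addrA [_ - _ + K]addrAC subrK addrC.
apply/is_core_inverse_dual; split.
- by rewrite /is_core_inverse PE.
- by rewrite AYBX mulmxDl KtA addr0 KA PE addrC subrK.
(* The left side is [P *m Y + K *m X]; [P] fixes every term of [Y] except [K *m X], which it
   kills. *)
- rewrite mulmxDr !mulmxA -addrA -mulmxDl AYBX PE.
  rewrite mulmxDl KtX addr0 {1}YE !mulmxDr !mulmxN !mulmxA.
  by rewrite PX PK mul0mx addr0 -YE.
- by rewrite AYBX linearD /= trmxK addrC.
Qed.

Theorem theorem3p5 (R : realType) (n : nat) (A B : 'M[R]_n) :
  has_dcgi (dual_mx A B) <->
  index_one A /\
  (1%:M - A *m core_inverse A) *m B *m (1%:M - core_inverse A *m A) = 0.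
Proof.
rewrite has_dcgiP; split=> [[X [Y /is_core_inverse_dual[cX eqB _ _]]] | [indA]].
  split; first exact: core_inverse_index_one cX.
  rewrite (core_inverseE cX); have [AXA _ _] := cX.
  have QA : (1%:M - A *m X) *m A = 0 by rewrite mulmxBl mul1mx AXA subrr.
  have AQ : A *m (1%:M - X *m A) = 0 by rewrite mulmxBr mulmx1 mulmxA AXA subrr.
  move: (1%:M - A *m X) (1%:M - X *m A) QA AQ => Q Q' QA AQ'.
  rewrite -eqB mulmxDl !mulmxDr !mulmxDl !mulmxA QA !mul0mx !add0r.
  by rewrite -(mulmxA _ A Q') AQ' mulmx0.
have [X cX] := index_one_core_inverse indA; rewrite (core_inverseE cX) => condB.
by exists X; apply: dual_core_inverse_exists.
Qed.
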